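(* Let $(A,\cdot)$ be an algebra, let $(A^*,\star)$ be an algebra structure on the dual vector space of $A$, and let $\Delta_A:A\to A\otimes A$ be the comultiplication dual to $\star$. Then the following are equivalent: (i) $(A,\cdot,\Delta_A)$ is a nearly associative bialgebra; (ii) $(A,\cdot,\Delta_A)$ is an $R$-bialgebra; (iii) $(A,\cdot,\Delta_A)$ is an $L$-bialgebra; (iv) $(A,\cdot,\Delta_A)$ is an $LR$-bialgebra.
   Context: All vector spaces are finite-dimensional over a field $\mathbb{K}$ of characteristic zero. An algebra is a vector space with a bilinear product (not necessarily associative). An algebra is nearly associative if $(xy)z=y(zx)$; an $R$-algebra if $(xy)z=(xz)y$; an $L$-algebra if $x(yz)=y(xz)$; an $LR$-algebra if it is both an $L$-algebra and an $R$-algebra (identities for all $x,y,z$). A nearly associative $L$-algebra is one that is both nearly associative and an $L$-algebra. The comultiplication $\Delta_A$ dual to $\star$ is given by $\langle\Delta_A(x),f\otimes g\rangle=\langle x,f\star g\rangle$, where $\langle x\otimes y,f\otimes g\rangle=f(x)g(y)$. On $D(A)=A\oplus A^*$ define $$(x+f)\diamond(y+g)=\big(x\cdot y+L_f^*(y)+R_g^*(x)\big)+\big(f\star g+L_x^*(g)+R_y^*(f)\big),$$ where $L_x^*(g),R_y^*(f)\in A^*$ are given by $L_x^*(g)(z)=g(z\cdot x)$, $R_y^*(f)(z)=f(y\cdot z)$, and $L_f^*(y),R_g^*(x)\in A$ are determined (identifying $A$ with $A^{**}$) by $\langle L_f^*(y),h\rangle=\langle y,h\star f\rangle$ and $\langle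 R_g^*(x),h\rangle=\langle x,g\star h\rangle$ for $h\in A^*$. The triple $(A,\cdot,\Delta_A)$ is a nearly associative bialgebra if $(A,\cdot)$ and $(A^*,\star)$ are nearly associative $L$-algebras and $(D(A),\diamond)$ is a nearly associative algebra. For $M$ one of the classes of $R$-algebras, $L$-algebras, $LR$-algebras, the triple is an $M$-bialgebra (called an $R$-bialgebra, $L$-bialgebra, $LR$-bialgebra respectively) if $(A,\cdot)$, $(A^*,\star)$ and $(D(A),\diamond)$ all belong to $M$. *)

(* Defs.v *)
From HB Require Import structures.
From mathcomp Require Import all_boot all_order all_algebra.

Set Implicit Arguments.
Unset Strict Implicit.
Unset Printing Implicit Defensive.

Import GRing.Theory.
Local Open Scope ring_scope.

Section AlgebraClasses.
Variables (K : fieldType) (V : vectType K).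
Implicit Type m : {bilinear V -> V -> V}.

Definition nearly_associative m :=
  forall x y z : V, m (m x y) z = m y (m z x).

Definition R_algebra m :=
  forall x y z : V, m (m x y) z = m (m x z) y.

Definition L_algebra m :=
  forall x y z : V, m x (m y z) = m y (m x z).

Definition LR_algebra m := L_algebra m /\ R_algebra m.

Definition nearly_associative_L m := nearly_associative m /\ L_algebra m.

End AlgebraClasses.

Notation dual V := 'Hom(V, (_)^o).

Section Bidual.
Variables (K : fieldType) (V : vectType K).

Definition ev_at (x : V) (f : dual V) : K^o := f x.

Fact ev_at_linear x : linear (ev_at x).
Proof. by move=> a f g; rewrite /ev_at add_lfunE scale_lfunE. Qed.
HB.instance Definition _ x :=
  GRing.isLinear.Build K (dual V) K^o *:%R (ev_at x) (ev_at_linear x).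

Definition ev_fun (x : V) : dual (dual V) := linfun (ev_at x).

Lemma ev_funE x f : ev_fun x f = f x.
Proof. by rewrite lfunE. Qed.

Fact ev_fun_linear : linear ev_fun.
Proof.
move=> a x y; apply/lfunP=> f.
by rewrite add_lfunE scale_lfunE !ev_funE linearP.
Qed.
HB.instance Definition _ :=
  GRing.isLinear.Build K V (dual (dual V)) *:%R ev_fun ev_fun_linear.

Definition ev : 'Hom(V, dual (dual V)) := linfun ev_fun.

Lemma evE x f : ev x f = f x.
Proof. by rewrite lfunE ev_funE. Qed.

Lemma dual_separates (x : V) : (forall f : dual V, f x = 0) -> x = 0.
Proof.
move=> x0.
pose b := vbasis {: V}.
rewrite (coord_vbasis (memvf x)) big1 // => i _.
have := x0 (linfun (coord b i : V -> K^o)).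
by rewrite lfunE /= => ->; rewrite scale0r.
Qed.

Lemma dual_ext (x y : V) : (forall f : dual V, f x = f y) -> x = y.
Proof.
move=> xy; apply/eqP; rewrite -subr_eq0; apply/eqP/dual_separates=> f.
by rewrite linearB /= xy subrr.
Qed.

Lemma lker_ev : lker ev = 0%VS.
Proof.
apply/eqP/lker0P=> x y exy; apply: dual_ext => f.
by rewrite -!evE exy.
Qed.

Lemma limg_ev : limg ev = fullv.
Proof.
apply/eqP; rewrite eqEdim subvf /= limg_dim_eq ?lker_ev ?capv0 //.
by rewrite !dimvf /dim /= /dim /= !muln1.
Qed.

Lemma evK : cancel (ev^-1)%VF ev.
Proof. by move=> phi; apply: limg_lfunVK; rewrite limg_ev memvf. Qed.

(* the identification of V with its bidual, read from V^** to V *)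
Lemma ev_invE (phi : dual (dual V)) (h : dual V) : h ((ev^-1)%VF phi) = phi h.
Proof. by rewrite -evE evK. Qed.

End Bidual.

(* The space [U (x) V] is realised as [Hom(U^*, V)], with [u (x) v] the map
   f |-> f(u) v; [tensor_universal] is its universal property. *)
Notation tensor U V := 'Hom(dual U, V).

Section Tensor.
Variables (K : fieldType) (U V : vectType K).

Definition tens_fun (u : U) (v : V) (f : dual U) : V := (f u : K) *: v.

Fact tens_fun_linear u v : linear (tens_fun u v).
Proof.
move=> a f g; rewrite /tens_fun add_lfunE scale_lfunE.
by rewrite scalerDl scalerA.
Qed.
HB.instance Definition _ u v :=
  GRing.isLinear.Build K (dual U) V *:%R (tens_fun u v) (tens_fun_linear u v).

Definition tens (u : U) (v : V) : tensor U V := linfun (tens_fun u v).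

Lemma tensE u v f : tens u v f = (f u : K) *: v.
Proof. by rewrite lfunE. Qed.

Fact tens_bilinear : bilinear_for *:%R *:%R tens.
Proof.
split=> w a x y; apply/lfunP=> f; rewrite add_lfunE scale_lfunE !tensE.
  by rewrite linearP scalerDl scalerA.
by rewrite scalerDr !scalerA mulrC.
Qed.
HB.instance Definition _ :=
  bilinear_isBilinear.Build K U V (tensor U V) *:%R *:%R tens tens_bilinear.

Definition pairing (t : tensor U V) (f : dual U) (g : dual V) : K := g (t f).

Lemma pairing_tens u v f g : pairing (tens u v) f g = f u * g v.
Proof. by rewrite /pairing tensE linearZ. Qed.

Lemma pairing_ext (s t : tensor U V) :
  (forall f g, pairing s f g = pairing t f g) -> s = t.
Proof. by move=> st; apply/lfunP=> f; apply: dual_ext => g; apply: st. Qed.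

Let b := vbasis {: U}.
Let bs i : dual U := linfun (coord b i : U -> K^o).

Let bsE i u : bs i u = coord b i u.
Proof. by rewrite lfunE. Qed.

Lemma tens_decomp (t : tensor U V) :
  t = \sum_(i < \dim {: U}) tens b`_i (t (bs i)).
Proof.
apply/lfunP=> f; rewrite sum_lfunE.
have fE : f = \sum_(i < \dim {: U}) (f b`_i : K) *: bs i.
  apply/lfunP=> u; rewrite sum_lfunE {1}(coord_vbasis (memvf u)) linear_sum.
  by apply: eq_bigr => i _; rewrite linearZ scale_lfunE bsE /= [RHS]mulrC.
by rewrite {1}fE linear_sum; apply: eq_bigr => i _; rewrite linearZ tensE.
Qed.

Lemma tensor_universal (W : vectType K) (B : {bilinear U -> V -> W}) :
  exists! phi : 'Hom(tensor U V, W), forall u v, phi (tens u v) = B u v.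
Proof.
pose phi0 (t : tensor U V) := \sum_(i < \dim {: U}) B b`_i (t (bs i)).
have phi0_lin : linear phi0.
  move=> a s t; rewrite /phi0 scaler_sumr -big_split; apply: eq_bigr => i _ /=.
  by rewrite add_lfunE scale_lfunE linearPr.
pose L := GRing.isLinear.Build K (tensor U V) W *:%R phi0 phi0_lin.
pose phi : {linear tensor U V -> W} := HB.pack phi0 L.
exists (linfun phi); split=> [u v|psi psiE].
  rewrite lfunE /= /phi0 [in RHS](coord_vbasis (memvf u)) linear_sumlz.
  by apply: eq_bigr => i _; rewrite tensE bsE linearZl_LR linearZr_LR.
apply/lfunP=> t; rewrite lfunE /= /phi0 [in RHS](tens_decomp t) linear_sum.
by apply: eq_bigr => i _; rewrite /= psiE.
Qed.

End Tensor.

Section Comultiplication.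
Variables (K : fieldType) (A : vectType K).

Definition is_dual_comul (star : {bilinear dual A -> dual A -> dual A})
    (Delta : 'Hom(A, tensor A A)) :=
  forall (x : A) (f g : dual A), pairing (Delta x) f g = star f g x.

Section DualProduct.
Variable Delta : 'Hom(A, tensor A A).

Definition dual_prod_at (f g : dual A) (x : A) : K^o := pairing (Delta x) f g.

Fact dual_prod_at_linear f g : linear (dual_prod_at f g).
Proof.
by move=> a x y; rewrite /dual_prod_at /pairing linearP add_lfunE
  scale_lfunE linearP.
Qed.
HB.instance Definition _ f g := GRing.isLinear.Build K A K^o *:%R
  (dual_prod_at f g) (dual_prod_at_linear f g).

Definition dual_prod (f g : dual A) : dual A := linfun (dual_prod_at f g).

Lemma dual_prodE f g x : dual_prod f g x = pairing (Delta x) f g.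
Proof. by rewrite lfunE. Qed.

Fact dual_prod_bilinear : bilinear_for *:%R *:%R dual_prod.
Proof.
split=> h a f g; apply/lfunP=> x;
  rewrite add_lfunE scale_lfunE !dual_prodE /pairing.
  by rewrite !linearP.
by rewrite add_lfunE scale_lfunE.
Qed.
HB.instance Definition _ := bilinear_isBilinear.Build K (dual A) (dual A)
  (dual A) *:%R *:%R dual_prod dual_prod_bilinear.

End DualProduct.

Lemma dual_prod_is_dual Delta : is_dual_comul (dual_prod Delta) Delta.
Proof. by move=> x f g; rewrite dual_prodE. Qed.

Lemma is_dual_comul_prod star Delta :
  is_dual_comul star Delta -> forall f g, dual_prod Delta f g = star f g.
Proof. by move=> dD f g; apply/lfunP=> x; rewrite dual_prodE dD. Qed.

Lemma is_dual_comul_exists_unique star :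
  exists! Delta, is_dual_comul star Delta.
Proof.
pose st x f g : K^o := star f g x.
have st_lin x f : linear (st x f).
  by move=> a g h; rewrite /st linearPr add_lfunE scale_lfunE.
pose stL x f : {linear dual A -> K^o} := HB.pack (st x f)
  (GRing.isLinear.Build K (dual A) K^o *:%R (st x f) (st_lin x f)).
pose D x f : A := (ev A)^-1%VF (linfun (stL x f)).
have DE x (f g : dual A) : g (D x f) = star f g x by rewrite ev_invE lfunE.
have D_lin x : linear (D x).
  move=> a f f'; apply: dual_ext => g.
  by rewrite DE [RHS]linearP /= !DE linearPl add_lfunE scale_lfunE.
pose DL x : {linear dual A -> A} := HB.pack (D x)
  (GRing.isLinear.Build K (dual A) A *:%R (D x) (D_lin x)).
pose DD x : tensor A A := linfun (DL x).
have DDE x (f g : dual A) : g (DD x f) = star f g x by rewrite lfunE DE.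
have DD_lin : linear DD.
  move=> a x y; apply/lfunP=> f; apply: dual_ext => g.
  rewrite add_lfunE scale_lfunE [RHS]linearP /= !DDE linearP.
  by [].
pose Delta : {linear A -> tensor A A} := HB.pack DD
  (GRing.isLinear.Build K A (tensor A A) *:%R DD DD_lin).
exists (linfun Delta); split=> [x f g|Delta' dD'].
  by rewrite /pairing lfunE DDE.
by apply/lfunP=> x; apply: pairing_ext => f g; rewrite dD' /pairing lfunE DDE.
Qed.

End Comultiplication.

Section Transposes.
Variables (K : fieldType) (V : vectType K) (m : {bilinear V -> V -> V}).

(* [Lstar x] transposes z |-> z x and [Rstar y] transposes z |-> y z, not the
   other way round. *)
Definition Lstar_at (x : V) (g : dual V) (z : V) : K^o := g (m z x).
Definition Rstar_at (y : V) (f : dual V) (z : V) : K^o := f (m y z).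

Fact Lstar_at_linear x g : linear (Lstar_at x g).
Proof. by move=> a u v; rewrite /Lstar_at linearPl linearP. Qed.
Fact Rstar_at_linear y f : linear (Rstar_at y f).
Proof. by move=> a u v; rewrite /Rstar_at linearPr linearP. Qed.
HB.instance Definition _ x g :=
  GRing.isLinear.Build K V K^o *:%R (Lstar_at x g) (Lstar_at_linear x g).
HB.instance Definition _ y f :=
  GRing.isLinear.Build K V K^o *:%R (Rstar_at y f) (Rstar_at_linear y f).

Definition Lstar (x : V) (g : dual V) : dual V := linfun (Lstar_at x g).
Definition Rstar (y : V) (f : dual V) : dual V := linfun (Rstar_at y f).

Lemma LstarE x g z : Lstar x g z = g (m z x).
Proof. by rewrite lfunE. Qed.

Lemma RstarE y f z : Rstar y f z = f (m y z).
Proof. by rewrite lfunE. Qed.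

Fact Lstar_bilinear : bilinear_for *:%R *:%R Lstar.
Proof.
split=> w a u v; apply/lfunP=> z; rewrite add_lfunE scale_lfunE !LstarE.
  by rewrite linearPr linearP.
by rewrite add_lfunE scale_lfunE.
Qed.
HB.instance Definition _ := bilinear_isBilinear.Build K V (dual V) (dual V)
  *:%R *:%R Lstar Lstar_bilinear.

Fact Rstar_bilinear : bilinear_for *:%R *:%R Rstar.
Proof.
split=> w a u v; apply/lfunP=> z; rewrite add_lfunE scale_lfunE !RstarE.
  by rewrite linearPl linearP.
by rewrite add_lfunE scale_lfunE.
Qed.
HB.instance Definition _ := bilinear_isBilinear.Build K V (dual V) (dual V)
  *:%R *:%R Rstar Rstar_bilinear.

End Transposes.

Section Double.
Variables (K : fieldType) (A : vectType K).
Variables (mul : {bilinear A -> A -> A}).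
Variables (star : {bilinear dual A -> dual A -> dual A}).

(* the maps L_f^* and R_g^* of the algebra A^*, brought back from A^** to A *)
Definition Lstar_dual (f : dual A) (y : A) : A :=
  (ev A)^-1%VF (Lstar star f (ev A y)).
Definition Rstar_dual (g : dual A) (x : A) : A :=
  (ev A)^-1%VF (Rstar star g (ev A x)).

Lemma Lstar_dualE f y (h : dual A) : h (Lstar_dual f y) = star h f y.
Proof. by rewrite ev_invE LstarE evE. Qed.

Lemma Rstar_dualE g x (h : dual A) : h (Rstar_dual g x) = star g h x.
Proof. by rewrite ev_invE RstarE evE. Qed.

Fact Lstar_dual_bilinear : bilinear_for *:%R *:%R Lstar_dual.
Proof.
by split=> w a u v; rewrite /Lstar_dual ?(linearP (ev A)) ?linearPl ?linearPr
  linearP.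
Qed.
HB.instance Definition _ := bilinear_isBilinear.Build K (dual A) A A
  *:%R *:%R Lstar_dual Lstar_dual_bilinear.

Fact Rstar_dual_bilinear : bilinear_for *:%R *:%R Rstar_dual.
Proof.
by split=> w a u v; rewrite /Rstar_dual ?(linearP (ev A)) ?linearPl ?linearPr
  linearP.
Qed.
HB.instance Definition _ := bilinear_isBilinear.Build K (dual A) A A
  *:%R *:%R Rstar_dual Rstar_dual_bilinear.

Definition double_mul (X Y : A * dual A) : A * dual A :=
  let: (x, f) := X in let: (y, g) := Y in
  (mul x y + Lstar_dual f y + Rstar_dual g x,
   star f g + Lstar mul x g + Rstar mul y f).

Let scaleD3 (V : lmodType K) (a : K) (p1 q1 p2 q2 p3 q3 : V) :
  (a *: p1 + q1) + (a *: p2 + q2) + (a *: p3 + q3)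
  = a *: (p1 + p2 + p3) + (q1 + q2 + q3).
Proof.
by rewrite !scalerDr (addrACA (a *: p1)) (addrACA (a *: p1 + a *: p2)).
Qed.

Fact double_mul_bilinear : bilinear_for *:%R *:%R double_mul.
Proof.
split=> -[z h] a [x f] [y g]; congr pair => /=; rewrite -scaleD3;
  by rewrite !(linearPl, linearPr).
Qed.
HB.instance Definition _ := bilinear_isBilinear.Build K (A * dual A)%type
  (A * dual A)%type (A * dual A)%type *:%R *:%R double_mul double_mul_bilinear.

End Double.

(* A bialgebra is a triple (A, mul, Delta): the product of A^* is recovered
   from Delta by transposition, see [is_dual_comul_prod]. *)
Section Bialgebras.
Variables (K : fieldType) (A : vectType K).
Variables (mul : {bilinear A -> A -> A}) (Delta : 'Hom(A, tensor A A)).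

Definition nearly_associative_bialgebra :=
  [/\ nearly_associative_L mul,
      nearly_associative_L (dual_prod Delta)
    & nearly_associative (double_mul mul (dual_prod Delta))].

Definition class_bialgebra
    (M : forall V : vectType K, {bilinear V -> V -> V} -> Prop) :=
  [/\ M A mul,
      M (dual A) (dual_prod Delta)
    & M (A * dual A)%type (double_mul mul (dual_prod Delta))].

Definition R_bialgebra := class_bialgebra (@R_algebra K).
Definition L_bialgebra := class_bialgebra (@L_algebra K).
Definition LR_bialgebra := class_bialgebra (@LR_algebra K).

End Bialgebras.

(* Main.v *)
Require Import Defs.
From HB Require Import structures.
From mathcomp Require Import all_boot all_order all_algebra.
Import GRing.Theory.
Local Open Scope ring_scope.

(** The pairing [B(x + f, y + g) = f(y) + g(x)] on [D(A)] is symmetric,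
    nondegenerate and satisfies [B(ab, c) = B(a, bc)].  In any algebra with
    such a form, moving the factors across [B] turns each of the identities
    (nearly associative, L, R) into another one, so the three are equivalent
    on [D(A)]; they are inherited by the subalgebras [A] and [A^*]. *)

Section InvariantForm.
Context {K : fieldType} {V : vectType K} {m : {bilinear V -> V -> V}}.
Context {B : V -> V -> K}.
Hypothesis B_sym : forall a b, B a b = B b a.
Hypothesis B_inv : forall a b c, B (m a b) c = B a (m b c).
Hypothesis B_ext : forall a b, (forall c, B a c = B b c) -> a = b.

(** Both sides equal [B c (m a b)]: symmetry makes the trilinear form [B (m a b) c] invariant under
    cyclic rotation. *)
Let B_cyclic a b c : B (m a b) c = B b (m c a).
Proof. by rewrite B_sym -B_inv B_sym. Qed.

(** Writing products by juxtaposition, L gives B((xy)z, t) = B(t(xy), z) = B(x(ty), z) = B(ty, zx) =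
    B(y(zx), t). Conversely, near associativity gives B(x(yz), t) = B(y, z(tx)) = B(y, (xz)t) =
    B(y(xz), t). *)
Lemma invariant_form_L_nearly_associative :
  L_algebra m <-> nearly_associative m.
Proof.
split=> mP x y z; apply: B_ext => t.
  by rewrite B_sym -B_inv mP B_cyclic B_inv B_sym.
by rewrite B_cyclic B_inv -mP -B_inv.
Qed.

(** Since B((tx)y, z) = B(t, x(yz)), exchanging x and y on the left is the R-identity and on the
    right the L-identity. *)
Lemma invariant_form_R_L : R_algebra m <-> L_algebra m.
Proof.
split=> mP x y z; apply: B_ext => t.
  by rewrite B_sym -!B_inv mP B_inv B_inv B_sym.
by rewrite !B_inv mP.
Qed.

End InvariantForm.

Section Subalgebra.
Context {K : fieldType} {V W : vectType K}.
Context {m : {bilinear V -> V -> V}} {n : {bilinear W -> W -> W}} {i : V -> W}.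
Hypothesis i_inj : injective i.
Hypothesis iM : forall x y, i (m x y) = n (i x) (i y).

Lemma subalgebra_nearly_associative :
  nearly_associative n -> nearly_associative m.
Proof. by move=> nP x y z; apply: i_inj; rewrite !iM nP. Qed.

Lemma subalgebra_R : R_algebra n -> R_algebra m.
Proof. by move=> nP x y z; apply: i_inj; rewrite !iM nP. Qed.

Lemma subalgebra_L : L_algebra n -> L_algebra m.
Proof. by move=> nP x y z; apply: i_inj; rewrite !iM nP. Qed.

End Subalgebra.

Section DoubleForm.
Context {K : fieldType} {A : vectType K}.
Variables (mul : {bilinear A -> A -> A}).
Variables (star : {bilinear dual A -> dual A -> dual A}).

Definition double_form (X Y : A * dual A) : K := X.2 Y.1 + Y.2 X.1.

Lemma double_form_sym X Y : double_form X Y = double_form Y X.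
Proof. exact: addrC. Qed.

Lemma double_form_ext X Y :
  (forall Z, double_form X Z = double_form Y Z) -> X = Y.
Proof.
(* Testing against (0, h) recovers the component in A, testing against (z, 0) the one in its
   dual. *)
case: X Y => [x f] [y g] XY; congr pair.
  apply: dual_ext => h; have := XY (0, h).
  by rewrite /double_form /= !linear0 !add0r.
apply/lfunP=> z; have := XY (z, 0).
by rewrite /double_form /= !zero_lfunE !addr0.
Qed.

(** For X = (x, f), Y = (y, g), Z = (z, h), both sides expand to the cyclically symmetric sum f(yz)
    + g(zx) + h(xy) + (f⋆g)(z) + (g⋆h)(x) + (h⋆f)(y). *)
Lemma double_form_inv X Y Z :
  double_form (double_mul mul star X Y) Z =
  double_form X (double_mul mul star Y Z).
Proof.
case: X Y Z => [x f] [y g] [z h]; rewrite /double_form /=.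
rewrite !add_lfunE !linearD /= !LstarE !RstarE !Lstar_dualE !Rstar_dualE.
by rewrite !addrA [LHS](ACl (3*1*5*6*4*2)).
Qed.

Lemma double_mul_inl x y :
  (mul x y, 0) = double_mul mul star (x, 0) (y, 0).
Proof. by rewrite /= !linear0r !linear0l !addr0. Qed.

Lemma double_mul_inr f g :
  (0, star f g) = double_mul mul star (0, f) (0, g).
Proof. by rewrite /= !linear0r !linear0l !addr0. Qed.

Lemma double_nearly_associative_L :
  nearly_associative (double_mul mul star) <-> L_algebra (double_mul mul star).
Proof.
apply: iff_sym; apply: invariant_form_L_nearly_associative.
- exact: double_form_sym.
- exact: double_form_inv.
- exact: double_form_ext.
Qed.

Lemma double_R_L :
  R_algebra (double_mul mul star) <-> L_algebra (double_mul mul star).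
Proof.
apply: invariant_form_R_L.
- exact: double_form_sym.
- exact: double_form_inv.
- exact: double_form_ext.
Qed.

End DoubleForm.

Theorem mainTheorem2 (K : fieldType) (charK : [pchar K] =i pred0)
    (A : vectType K) (mul : {bilinear A -> A -> A})
    (star : {bilinear dual A -> dual A -> dual A})
    (Delta : 'Hom(A, tensor A A)) (dualDelta : is_dual_comul star Delta) :
  [<-> nearly_associative_bialgebra mul Delta;
       R_bialgebra mul Delta;
       L_bialgebra mul Delta;
       LR_bialgebra mul Delta].
Proof.
have inl_inj : injective (fun x : A => (x, 0 : dual A)) by move=> x y [].
have inr_inj : injective (fun f : dual A => (0 : A, f)) by move=> f g [].
have inlM := double_mul_inl mul (dual_prod Delta).
have inrM := double_mul_inr mul (dual_prod Delta).
have [NA_L L_NA] := double_nearly_associative_L mul (dual_prod Delta).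
have [R_L L_R] := double_R_L mul (dual_prod Delta).
tfae.
(* Only the identity on the double is kept: it is converted to R by way of L, then restricted to
   both summands. *)
- case=> _ _ /NA_L/L_R DR; split=> //.
  + exact: subalgebra_R inl_inj inlM DR.
  + exact: subalgebra_R inr_inj inrM DR.
- case=> _ _ /R_L DL; split=> //.
  + exact: subalgebra_L inl_inj inlM DL.
  + exact: subalgebra_L inr_inj inrM DL.
- case=> AL dAL DL; have DR := L_R DL; split; split=> //.
  + exact: subalgebra_R inl_inj inlM DR.
  + exact: subalgebra_R inr_inj inrM DR.
(* The L-identities on both summands come from the hypothesis; near associativity is restricted from
   the double. *)
- case=> -[AL _] [dAL _] [/L_NA DN _]; split=> //; split=> //.
  + exact: subalgebra_nearly_associative inl_inj inlM DN.
  + exact: subalgebra_nearly_associative inr_inj inrM DN.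
Qed.
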